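(* Let $\mathsf\Omega$ be a finite category, let $\Theta,\Lambda$ be functors from $\mathsf\Omega^{\mathrm{op}}$ to finite sets, let $k\supseteq\mathbb Q$ be a field, and let $A,B,C^\bullet$ be as in the context. Let $g=(g_\omega:\Theta(\omega)\to\Lambda(\omega))_\omega$ be any family of maps (a deterministic design-indexed quantity), with associated $0$-cochain $g^*$ and defect $c_g=d^0g^*$, and let $\mathcal C\subseteq C^0$ be a linear subspace. (i) There is $h\in\mathcal C$ such that $g^*+h$ is natural if and only if the class of $c_g$ in $H^1(C^\bullet_{\mathcal C})$ is zero, and such an $h$ is unique modulo $\mathcal C\cap\mathrm{Nat}(B,A)$. (ii) The image of this class in $H^1(\mathsf\Omega;\mathrm{Hom}_k(B,A))=H^1(C^\bullet)$ is zero for every $g$. (iii) In the one-way layout with two groups and finitely many values of the mean and of the dispersion (see context), let $\mathcal C_1=\{h\in C^0: h_{\omega_1}=0\}$ be the subspace of the $0$-cochains which vanish at the merged design $\omega_1$. Then $\mathcal C_1\cap\mathrm{Nat}(B,A)=0$, and the marginal dispersion $g$ has a unique correction $h\in\mathcal C_1$ (i.e. a unique $h\in\mathcal C_1$ with $g^*+h$ natural), and it gives the within-group dispersion: the component of $g^*+h$ at $\omega_2$ is the dual (precomposition) of the map $((\mu_1,\mu_2),s)\mapsto s$.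
   Context: $A(\omega)=k^{\Theta(\omega)}$ and $B(\omega)=k^{\Lambda(\omega)}$ are the algebras of $k$-valued functions; $A,B$ are covariant functors on $\mathsf\Omega$ via $A(\psi)=\Theta(\psi)^*$, $B(\psi)=\Lambda(\psi)^*$ (precomposition). $\mathrm{Hom}_k$ denotes $k$-linear maps. $C^\bullet$ is the Baues–Wirsching complex of $\mathsf\Omega$ with coefficients in $\mathrm{Hom}_k(B,A)$: $C^n$ is the product, over composable strings $\omega_0\xrightarrow{\psi_1}\omega_1\to\cdots\xrightarrow{\psi_n}\omega_n$ in $\mathsf\Omega$ (over the objects if $n=0$), of $\mathrm{Hom}_k(B(\omega_0),A(\omega_n))$, with $$(d^nc)(\psi_1,\dots,\psi_{n+1})=A(\psi_{n+1})c(\psi_1,\dots,\psi_n)+\sum_{i=1}^n(-1)^i c(\dots,\psi_{n+2-i}\psi_{n+1-i},\dots)+(-1)^{n+1}c(\psi_2,\dots,\psi_{n+1})B(\psi_1).$$ In particular, for $\psi:\omega\to\omega'$, $(d^0h)(\psi)=A(\psi)h_\omega-h_{\omega'}B(\psi)$. $\mathrm{Nat}(B,A)=\ker d^0=H^0$ is the space of the natural families of $k$-linear maps $B(\omega)\to A(\omega)$; a $0$-cochain is natural if it lies in $\mathrm{Nat}(B,A)$. $C^\bullet_{\mathcal C}\subseteq C^\bullet$ is the subcomplex with $C^0_{\mathcal C}=\mathcal C$ and $C^n_{\mathcal C}=C^n$ for $n\ge1$. For a family $g$, $g^*=(g_\omega^*:B(\omega)\to A(\omega))_\omega\in C^0$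 is the family of precompositions. A correction of $g$ in $\mathcal C$ is $h\in\mathcal C$ with $g^*+h$ natural. One-way layout with two groups. $\mathsf\Omega=\mathsf\Omega_{\mathrm{full}}$ is the full subcategory of finite sets on $\omega_1=\{*\}$ and $\omega_2=\{1,2\}$; its non-identity morphisms are the merge $p:\omega_2\to\omega_1$, the selections $i_1,i_2:\omega_1\to\omega_2$ ($i_k( * )=k$), the swap $\sigma$ of $\omega_2$, and the constants $c_k=i_kp$. Let $M\subset\mathbb Q$ (means) and $S\subset\mathbb Q_{>0}$ (dispersions) be finite non-empty sets, $\Theta(\omega)=M^\omega\times S$ with $\Theta(\psi)(\mu',s)=(\mu'\circ\psi,s)$. The marginal dispersion is $g_{\omega_1}(\mu,s)=s$, $g_{\omega_2}((\mu_1,\mu_2),s)=s+(\mu_1-\mu_2)^2/4$. The target $\Lambda$ is constant at $T=g_{\omega_2}(\Theta(\omega_2))\supseteq S$, with $\Lambda(\psi)=\mathrm{id}_T$. *)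

(* Defs.v *)
From HB Require Import structures.
From mathcomp Require Import all_boot all_order all_algebra.
From mathcomp Require Import ring_quotient generic_quotient.
From mathcomp Require Import boolp finmap.

Set Implicit Arguments.
Unset Strict Implicit.
Unset Printing Implicit Defensive.

Import Order.TTheory GRing.Theory Num.Theory.
Local Open Scope ring_scope.
Local Open Scope quotient_scope.

Record fincat := FinCat {
  ob :> finType;
  mor : ob -> ob -> finType;
  idmor : forall x, mor x x;
  compmor : forall x y z, mor y z -> mor x y -> mor x z;
  comp1m : forall x y (f : mor x y), compmor (idmor y) f = f;
  compm1 : forall x y (f : mor x y), compmor f (idmor x) = f;
  compmorA : forall x y z t (h : mor z t) (g : mor y z) (f : mor x y),
    compmor h (compmor g f) = compmor (compmor h g) f
}.
Arguments mor {Om} x y : rename.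
Arguments idmor {Om} x : rename.
Arguments compmor {Om x y z} g f : rename.

Record presheaf (Om : fincat) := Presheaf {
  pob :> Om -> finType;
  pmor : forall x y : Om, mor x y -> pob y -> pob x;
  pmor1 : forall x (t : pob x), pmor (idmor x) t = t;
  pmorM : forall (x y z : Om) (g : mor y z) (f : mor x y) (t : pob z),
    pmor (compmor g f) t = pmor f (pmor g t)
}.
Arguments pmor {Om} F {x y} f t : rename.

Record complex (k : fieldType) := Complex {
  cob :> nat -> lmodType k;
  cd : forall n, {linear cob n -> cob n.+1};
  cdd : forall n (x : cob n), cd n.+1 (cd n x) = 0
}.
Arguments cd {k C} n : rename.

Section Cohomology.
Variables (k : fieldType) (C : complex k).

Definition is_cocycle n : {pred C n} := fun x => cd n x == 0.
Arguments is_cocycle : clear implicits.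

Fact cocycle_submod n : submod_closed (is_cocycle n).
Proof.
split=> [|a x y]; rewrite !unfold_in ?linear0 //.
by move=> /eqP dx /eqP dy; rewrite linearP dx dy scaler0 addr0.
Qed.
HB.instance Definition _ n :=
  GRing.isSubmodClosed.Build k (C n) (is_cocycle n) (cocycle_submod n).

Record cocycles n :=
  Cocycle { cocycle_val : C n; cocycleP : cocycle_val \in is_cocycle n }.
HB.instance Definition _ n := [isSub for @cocycle_val n].
HB.instance Definition _ n := [Choice of cocycles n by <:].
HB.instance Definition _ n := [SubChoice_isSubLmodule of cocycles n by <:].

Definition is_boundary n : {pred cocycles n} :=
  match n return {pred cocycles n} with
  | 0 => fun z => z == 0
  | m.+1 => fun z => `[< exists y : C m, cocycle_val z = cd m y >]
  end.
Arguments is_boundary : clear implicits.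

Fact boundary_submod n : submod_closed (is_boundary n).
Proof.
case: n => [|n]; split=> [|a x y]; rewrite !unfold_in /=.
- exact: eqxx.
- by move=> /eqP -> /eqP ->; rewrite scaler0 addr0.
- by apply/asboolP; exists 0; rewrite linear0.
move=> /asboolP[u xE] /asboolP[v yE]; apply/asboolP.
by exists (a *: u + v); rewrite linearP -xE -yE.
Qed.
HB.instance Definition _ n :=
  GRing.isSubmodClosed.Build k (cocycles n) (is_boundary n) (boundary_submod n).

Definition cohomology n : Type := Quotient.quot (is_boundary n).
HB.instance Definition _ n := GRing.Zmodule.on (cohomology n).
HB.instance Definition _ n := Quotient.on (cohomology n).

Definition coh_class n (z : cocycles n) : cohomology n := \pi_(cohomology n) z.

Lemma coh_class_eq n (z z' : cocycles n) :
  coh_class z = coh_class z' <-> z - z' \in is_boundary n.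
Proof. by rewrite Quotient.idealrBE; split=> [/eqP|/eqP]. Qed.

Fact coh_class_zmod n : zmod_morphism (@coh_class n).
Proof. by move=> x y; rewrite /coh_class piE. Qed.
HB.instance Definition _ n :=
  GRing.isZmodMorphism.Build (cocycles n) (cohomology n) (@coh_class n)
    (@coh_class_zmod n).

Definition coh_scale n (a : k) (x : cohomology n) : cohomology n :=
  coh_class (a *: repr x).

Fact coh_scale_class n a (z : cocycles n) :
  coh_scale a (coh_class z) = coh_class (a *: z).
Proof.
apply/coh_class_eq; rewrite -scalerBr rpredZ //; apply/coh_class_eq.
by rewrite /coh_class reprK.
Qed.

Fact coh_classP n (P : cohomology n -> Prop) :
  (forall z, P (coh_class z)) -> forall x, P x.
Proof. by move=> Pz x; rewrite -[x]reprK; apply: Pz. Qed.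

Fact coh_scalerA n a b (x : cohomology n) :
  coh_scale a (coh_scale b x) = coh_scale (a * b) x.
Proof. by elim/coh_classP: x => z; rewrite !coh_scale_class scalerA. Qed.
Fact coh_scale1r n : left_id 1 (@coh_scale n).
Proof. by elim/coh_classP=> z; rewrite coh_scale_class scale1r. Qed.
Fact coh_scalerDr n : right_distributive (@coh_scale n) +%R.
Proof.
move=> a; elim/coh_classP=> x; elim/coh_classP=> y.
by rewrite -raddfD !coh_scale_class scalerDr raddfD.
Qed.
Fact coh_scalerDl n (x : cohomology n) : {morph (@coh_scale n)^~ x : a b / a + b}.
Proof.
by elim/coh_classP: x => x a b; rewrite !coh_scale_class scalerDl raddfD.
Qed.
HB.instance Definition _ n := GRing.Zmodule_isLmodule.Build k (cohomology n)
  (@coh_scalerA n) (@coh_scale1r n) (@coh_scalerDr n) (@coh_scalerDl n).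

End Cohomology.

Record chain_map (k : fieldType) (C D : complex k) := ChainMap {
  cmap :> forall n, {linear C n -> D n};
  cmapd : forall n (x : C n), cmap n.+1 (cd n x) = cd n (cmap n x)
}.

Section CohomologyMap.
Variables (k : fieldType) (C D : complex k) (f : chain_map C D).

Fact cocycle_map_subproof n (z : cocycles C n) :
  f n (cocycle_val z) \in @is_cocycle k D n.
Proof.
by rewrite unfold_in -cmapd; have /eqP-> := cocycleP z; rewrite linear0.
Qed.
Definition cocycle_map n (z : cocycles C n) : cocycles D n :=
  Cocycle (cocycle_map_subproof z).

Definition coh_map n (x : cohomology C n) : cohomology D n :=
  coh_class (cocycle_map (repr x)).

Lemma coh_map_class n (z : cocycles C n) :
  coh_map (coh_class z) = coh_class (cocycle_map z).
Proof.
apply/coh_class_eq.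
have : repr (coh_class z) - z \in @is_boundary k C n.
  by apply/coh_class_eq; rewrite /coh_class reprK.
case: n z => [|n] z; rewrite !unfold_in /=.
  rewrite !subr_eq0 => /eqP->; exact: eqxx.
move=> /asboolP[y yE]; apply/asboolP; exists (f n y).
by rewrite -cmapd -yE raddfB.
Qed.

End CohomologyMap.

Section Subcomplex.
Variables (k : fieldType) (C : complex k) (S : submodClosed (C 0%N)).

Record sub0 := Sub0 { sub0_val : C 0; sub0P : sub0_val \in S }.
HB.instance Definition _ := [isSub for sub0_val].
HB.instance Definition _ := [Choice of sub0 by <:].
HB.instance Definition _ := [SubChoice_isSubLmodule of sub0 by <:].

Definition subcob (n : nat) : lmodType k :=
  match n with 0 => sub0 | m.+1 => C m.+1 end.

Definition sub_incl n : {linear subcob n -> C n} :=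
  match n return {linear subcob n -> C n} with
  | 0 => val
  | m.+1 => idfun
  end.

Definition subcd n : {linear subcob n -> subcob n.+1} :=
  cd n \o sub_incl n.

Fact subcdd n (x : subcob n) : subcd n.+1 (subcd n x) = 0.
Proof. exact: cdd. Qed.

Definition subcomplex : complex k := Complex subcdd.

Fact sub_inclD n (x : subcomplex n) :
  sub_incl n.+1 (cd n x) = cd n (sub_incl n x).
Proof. by []. Qed.
Definition subcomplex_incl : chain_map subcomplex C :=
  @ChainMap _ subcomplex C sub_incl sub_inclD.

End Subcomplex.

Section Strings.
Variable Om : fincat.
Implicit Types x y z : Om.

(* The composable strings x = w_0 -> w_1 -> ... -> w_n = y: the last morphism
   is the outermost component, as the faces below are numbered from the end. *)
Fixpoint strings (n : nat) (x y : Om) : Type :=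
  match n with
  | 0 => x = y
  | m.+1 => {w : Om & (strings m x w * mor w y)%type}
  end.

Definition snoc n x w z (t : strings n x w) (b : mor w z) : strings n.+1 x z :=
  existT _ w (t, b).

(* (psi_1, ..., psi_(n+2)) with psi_(n+1-i) and psi_(n+2-i) replaced by their
   composite, for i <= n; the values at i > n are irrelevant. *)
Fixpoint merge_at n (i : nat) x z : strings n.+2 x z -> strings n.+1 x z :=
  match n, i with
  | m.+1, j.+1 => fun s =>
      let: existT w (t, b) := s in existT _ w (merge_at j t, b)
  | _, _ => fun s =>
      let: existT w (existT v (u, a), b) := s in existT _ v (u, compmor b a)
  end.

Fixpoint behead_string n x z :
    strings n.+1 x z -> {w : Om & (mor x w * strings n w z)%type} :=
  match n with
  | 0 => fun s =>
      let: existT w (e, b) := s in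
      existT _ z
        (match e in _ = w return mor w z -> mor x z with erefl => id end b, erefl)
  | m.+1 => fun s =>
      let: existT w (t, b) := s in
      let: existT v (a, u) := behead_string t in
      existT _ v (a, existT _ w (u, b))
  end.
End Strings.

Section Precomposition.
Variables (k : fieldType) (S T : finType).

Definition precomp_fun (f : S -> T) (u : {ffun T -> k^o}) : {ffun S -> k^o} :=
  [ffun s => u (f s)].

Fact precomp_fun_linear f : linear (precomp_fun f).
Proof. by move=> a u v; apply/ffunP=> s; rewrite !ffunE. Qed.
HB.instance Definition _ f :=
  GRing.isLinear.Build k {ffun T -> k^o} {ffun S -> k^o} *:%R (precomp_fun f)
    (precomp_fun_linear f).

Definition precomp (f : S -> T) : 'Hom({ffun T -> k^o}, {ffun S -> k^o}) :=
  linfun (precomp_fun f).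

Lemma precompE f u s : precomp f u s = u (f s).
Proof. by rewrite lfunE /= ffunE. Qed.
End Precomposition.
Arguments precomp k {S T} f.

Lemma precomp_id (k : fieldType) (S : finType) (f : S -> S) :
  f =1 id -> precomp k f = \1%VF.
Proof.
by move=> fE; apply/lfunP=> u; apply/ffunP=> s; rewrite precompE fE id_lfunE.
Qed.

Lemma precomp_comp (k : fieldType) (S T U : finType) (f : S -> T) (g : T -> U)
    (h : S -> U) :
  h =1 g \o f -> precomp k h = (precomp k f \o precomp k g)%VF.
Proof.
move=> hE; apply/lfunP=> u; apply/ffunP=> s.
by rewrite comp_lfunE !precompE hE.
Qed.

Section BauesWirsching.
Variables (k : fieldType) (Om : fincat) (Th La : presheaf Om).
Implicit Types x y z w : Om.

Local Notation A x := {ffun Th x -> k^o}.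
Local Notation B x := {ffun La x -> k^o}.

Definition Amap x y (psi : mor x y) : 'Hom(A x, A y) := precomp k (pmor Th psi).
Definition Bmap x y (psi : mor x y) : 'Hom(B x, B y) := precomp k (pmor La psi).

Lemma Amap_comp x y z (g : mor y z) (f : mor x y) :
  Amap (compmor g f) = (Amap g \o Amap f)%VF.
Proof. by apply: precomp_comp => t; rewrite /= pmorM. Qed.

Lemma Bmap_comp x y z (g : mor y z) (f : mor x y) :
  Bmap (compmor g f) = (Bmap g \o Bmap f)%VF.
Proof. by apply: precomp_comp => t; rewrite /= pmorM. Qed.

Definition cochain n : Type :=
  forall x y, strings n x y -> 'Hom(B x, A y).

Lemma cochainP n (c c' : cochain n) :
  (forall x y s, c x y s = c' x y s) <-> c = c'.
Proof.
split=> [cE | -> //]; apply: functional_extensionality_dep => x.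
by apply: functional_extensionality_dep => y; apply/funext => s.
Qed.

HB.instance Definition _ n := gen_eqMixin (cochain n).
HB.instance Definition _ n := gen_choiceMixin (cochain n).

Section Module.
Variable n : nat.
Implicit Types c : cochain n.
Definition cochain_add c c' : cochain n := fun x y s => c x y s + c' x y s.
Definition cochain_opp c : cochain n := fun x y s => - c x y s.
Definition cochain_zero : cochain n := fun x y s => 0.
Definition cochain_scale (a : k) c : cochain n := fun x y s => a *: c x y s.

Fact cochain_addA : associative cochain_add.
Proof. by move=> *; apply/cochainP=> *; apply: addrA. Qed.
Fact cochain_addC : commutative cochain_add.
Proof. by move=> *; apply/cochainP=> *; apply: addrC. Qed.
Fact cochain_add0 : left_id cochain_zero cochain_add.
Proof. by move=> *; apply/cochainP=> *; apply: add0r. Qed.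
Fact cochain_addN : left_inverse cochain_zero cochain_opp cochain_add.
Proof. by move=> *; apply/cochainP=> *; apply: addNr. Qed.
HB.instance Definition _ := GRing.isZmodule.Build (cochain n)
  cochain_addA cochain_addC cochain_add0 cochain_addN.

Fact cochain_scaleA a b c :
  cochain_scale a (cochain_scale b c) = cochain_scale (a * b) c.
Proof. by apply/cochainP=> *; apply: scalerA. Qed.
Fact cochain_scale1 : left_id 1 cochain_scale.
Proof. by move=> *; apply/cochainP=> *; apply: scale1r. Qed.
Fact cochain_scaleDr : right_distributive cochain_scale +%R.
Proof. by move=> *; apply/cochainP=> *; apply: scalerDr. Qed.
Fact cochain_scaleDl c : {morph cochain_scale^~ c : a b / a + b}.
Proof. by move=> *; apply/cochainP=> *; apply: scalerDl. Qed.
HB.instance Definition _ := GRing.Zmodule_isLmodule.Build k (cochain n)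
  cochain_scaleA cochain_scale1 cochain_scaleDr cochain_scaleDl.
End Module.

Lemma cochainDE n (c c' : cochain n) x y s : (c + c') x y s = c x y s + c' x y s.
Proof. by []. Qed.
Lemma cochainZE n a (c : cochain n) x y s : (a *: c) x y s = a *: c x y s.
Proof. by []. Qed.

Definition inner_faces n (c : cochain n) x z (s : strings n.+1 x z) :
    'Hom(B x, A z) :=
  match n return cochain n -> strings n.+1 x z -> 'Hom(B x, A z) with
  | 0 => fun _ _ => 0
  | m.+1 => fun c s =>
      \sum_(1 <= i < m.+2) (-1) ^+ i *: c x z (merge_at i.-1 s)
  end c s.

(* (d^n c)(psi_1, ..., psi_(n+1)) =
     A(psi_(n+1)) c(psi_1, ..., psi_n)
     + sum_(1 <= i <= n) (-1)^i c(..., psi_(n+2-i) psi_(n+1-i), ...)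
     + (-1)^(n+1) c(psi_2, ..., psi_(n+1)) B(psi_1);
   the sum over i is inner_faces. *)
Definition bw_diff n (c : cochain n) : cochain n.+1 := fun x z s =>
  (let: existT w (t, b) := s in Amap b \o c x w t)%VF
  + inner_faces c s
  + (-1) ^+ n.+1 *:
      (let: existT w (a, t) := behead_string s in c w z t \o Bmap a)%VF.

Fact bw_diff_linear n : linear (@bw_diff n).
Proof.
move=> a c c'; apply/cochainP=> x z s.
rewrite !(cochainDE, cochainZE) /bw_diff.
case: s (behead_string s) => w [t b] [v [e u]].
rewrite !(cochainDE, cochainZE).
rewrite comp_lfunDr comp_lfunDl -comp_lfunZr -comp_lfunZl.
rewrite !scalerDr !scalerA [(-1) ^+ _ * a]mulrC.
have -> : inner_faces (a *: c + c') (existT _ w (t, b)) =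
  a *: inner_faces c (existT _ w (t, b)) + inner_faces c' (existT _ w (t, b)).
  case: n c c' w t b v e u => [|n] c c' w t b _ _ _ /=.
    by rewrite scaler0 addr0.
  rewrite scaler_sumr -big_split; apply: eq_bigr => i _ /=.
  by rewrite !(cochainDE, cochainZE) scalerDr !scalerA mulrC.
by rewrite (AC (2*2*2) ((1*3*5)*(2*4*6))).
Qed.
HB.instance Definition _ n :=
  GRing.isLinear.Build k (cochain n) (cochain n.+1) *:%R (@bw_diff n)
    (@bw_diff_linear n).

(* d d = 0: pdiff F is the alternating sum of all the faces other than the one
   removing the last morphism, computed by recursion from the end of a string;
   F takes its values in the maps to a fixed space V. *)

Section DiffDiff.

Fixpoint pdiff (V : vectType k) n :
    forall z (F : forall x, strings n x z -> 'Hom(B x, V)),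
    forall x, strings n.+1 x z -> 'Hom(B x, V) :=
  match n with
  | 0 => fun z F x s =>
      let: existT w (a, u) := behead_string s in - (F w u \o Bmap a)%VF
  | m.+1 => fun z F x s =>
      let: existT w (t, b) := s in
      let: existT v (u, a) := t in
      - F x (existT _ v (u, compmor b a))
      - pdiff (fun x' (t' : strings m x' w) => F x' (existT _ w (t', b))) t
  end.

Fact pdiffE (V : vectType k) n z (F : forall x, strings n x z -> 'Hom(B x, V))
    x (s : strings n.+1 x z) :
  pdiff F s =
  match n return (forall x, strings n x z -> 'Hom(B x, V)) ->
                 strings n.+1 x z -> 'Hom(B x, V) with
  | 0 => fun _ _ => 0
  | m.+1 => fun F s =>
      \sum_(1 <= i < m.+2) (-1) ^+ i *: F x (merge_at i.-1 s)
  end F s + (-1) ^+ n.+1 *: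
    (let: existT w (a, t) := behead_string s in F w t \o Bmap a)%VF.
Proof.
elim: n z F x s => [|n IHn] z F x s.
  rewrite add0r expr1 scaleN1r /=.
  by case: (match s with existT _ _ => _ end) => w [a u].
case: s => w [t b]; rewrite big_ltn // expr1 scaleN1r.
have -> : pdiff F (existT _ w (t, b) : strings n.+2 x z) =
  - F x (merge_at 0%N (existT _ w (t, b) : strings n.+2 x z))
  - pdiff (fun x' (t' : strings n x' w) =>
             F x' (existT _ w (t', b) : strings n.+1 x' z)) t.
  by case: t => v [u a]; case: n {IHn} F u.
rewrite -[RHS]addrA; congr (_ + _).
rewrite {}IHn opprD; congr (_ + _).
  case: n F t => [|n] F t; first by rewrite big_geq // oppr0.
  rewrite -sumrN [RHS]big_add1 /=; apply: eq_big_nat => -[//|i _].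
  by rewrite [in RHS]exprS mulN1r scaleNr.
rewrite -scaleNr -mulN1r -exprS.
by rewrite /=; case: (behead_string t) => v [a u].
Qed.

Lemma bw_diffE n (c : cochain n) x z (s : strings n.+1 x z) :
  bw_diff c s = (let: existT w (t, b) := s in Amap b \o c x w t)%VF
              + pdiff (fun x' => c x' z) s.
Proof. by rewrite pdiffE /bw_diff -addrA; case: n c s. Qed.

Fact pdiff_comp (V W : vectType k) (f : 'Hom(V, W)) n z
    (F : forall x, strings n x z -> 'Hom(B x, V)) x (s : strings n.+1 x z) :
  pdiff (fun x' t => (f \o F x' t)%VF) s = (f \o pdiff F s)%VF.
Proof.
elim: n z F x s => [|n IHn] z F x s /=.
  case: (match s with existT _ _ => _ end) => w [a u].
  by rewrite comp_lfunNr comp_lfunA.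
case: s => w [[v [u a]] b].
by rewrite comp_lfunDr !comp_lfunNr -IHn.
Qed.

Fact pdiffD (V : vectType k) n z
    (F G : forall x, strings n x z -> 'Hom(B x, V)) x (s : strings n.+1 x z) :
  pdiff (fun x' t => F x' t + G x' t) s = pdiff F s + pdiff G s.
Proof.
elim: n z F G x s => [|n IHn] z F G x s /=.
  case: (match s with existT _ _ => _ end) => w [a u].
  by rewrite comp_lfunDl opprD.
case: s => w [[v [u a]] b].
rewrite IHn !opprD; exact: (AC (2*2) ((1*3)*(2*4))).
Qed.

Fact pdiffN (V : vectType k) n z
    (F : forall x, strings n x z -> 'Hom(B x, V)) x (s : strings n.+1 x z) :
  pdiff (fun x' t => - F x' t) s = - pdiff F s.
Proof.
elim: n z F x s => [|n IHn] z F x s /=.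
  case: (match s with existT _ _ => _ end) => w [a u].
  by rewrite comp_lfunNl.
case: s => w [[v [u a]] b].
by rewrite IHn opprD.
Qed.

Fact pdiff_ext (V : vectType k) n z
    (F G : forall x, strings n x z -> 'Hom(B x, V)) x (s : strings n.+1 x z) :
  (forall x' t, F x' t = G x' t) -> pdiff F s = pdiff G s.
Proof.
move=> FG; congr (pdiff _ s); apply: functional_extensionality_dep => x'.
by apply/funext.
Qed.

Fact pdiffS (V : vectType k) n z (F : forall x, strings n.+1 x z -> 'Hom(B x, V))
    x v w (u : strings n x v) (a : mor v w) (b : mor w z) :
  pdiff F (snoc (snoc u a) b) =
  - F x (snoc u (compmor b a)) - pdiff (fun x' t => F x' (snoc t b)) (snoc u a).
Proof. by []. Qed.

Fact pdiffK (V : vectType k) n z (F : forall x, strings n x z -> 'Hom(B x, V))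
    x (s : strings n.+2 x z) :
  pdiff (fun x' (t : strings n.+1 x' z) => pdiff F t) s = 0.
Proof.
elim: n z F x s => [|n IHn] z F x s.
  case: s => w [[v [e a]] b]; case: _ / e a => a /=.
  by rewrite Bmap_comp comp_lfunNl comp_lfunA opprK subrr.
case: s => w [[v [[y [r e]] a]] b].
rewrite -[existT _ _ _]/(snoc (snoc (snoc r e) a) b) pdiffS pdiffS.
rewrite (@pdiff_ext _ _ _ _ (fun x' (t : strings n.+1 x' w) =>
    - (let: existT v (u, a) := t in F x' (snoc u (compmor b a)))
    - pdiff (fun x'' (t' : strings n x'' w) => F x'' (snoc t' b)) t));
  last by move=> x' [v' [u' a']].
rewrite pdiffD !pdiffN IHn subr0 opprK [X in _ + X]pdiffS -compmorA.
exact: addNr.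
Qed.

End DiffDiff.

Fact bw_diffK n (c : cochain n) : bw_diff (bw_diff c) = 0.
Proof.
apply/cochainP=> x z s; rewrite bw_diffE.
rewrite (@pdiff_ext _ _ _ _ (fun x' (t : strings n.+1 x' z) =>
    (let: existT w (t', b) := t in Amap b \o c x' w t')%VF
    + pdiff (fun x'' => c x'' z) t)); last by move=> *; rewrite bw_diffE.
rewrite pdiffD pdiffK addr0; case: s => w [[v [u a]] b].
rewrite bw_diffE comp_lfunDr /= pdiff_comp Amap_comp comp_lfunA.
by rewrite addrACA !subrr addr0.
Qed.

Definition BW : complex k :=
  @Complex k cochain (fun n => @bw_diff n) bw_diffK.

(* A string of length 0 from x to y is a proof of x = y, so that a 0-cochain
   amounts to a family of linear maps B x -> A x, its components. *)
Definition component (h : cochain 0%N) x : 'Hom(B x, A x) := h x x erefl.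

Definition cochain0 (f : forall x, 'Hom(B x, A x)) : cochain 0%N :=
  fun x y e => match e in _ = y return 'Hom(B x, A y) with erefl => f x end.

Lemma cochain0E f x : component (cochain0 f) x = f x. Proof. by []. Qed.

Lemma cochain0P (h h' : cochain 0%N) :
  (forall x, component h x = component h' x) -> h = h'.
Proof. by move=> hE; apply/cochainP=> x y e; case: _ / e; apply: hE. Qed.

Lemma bw_diff0E (h : cochain 0%N) x y (psi : mor x y) :
  bw_diff h (snoc (erefl : strings 0%N x x) psi) =
  (Amap psi \o component h x)%VF - (component h y \o Bmap psi)%VF.
Proof. by rewrite bw_diffE. Qed.

Definition Nat : {pred cochain 0%N} := @is_cocycle k BW 0%N.
HB.instance Definition _ :=
  GRing.isSubmodClosed.Build k (cochain 0%N) Nat (@cocycle_submod k BW 0%N).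

Lemma NatP (h : cochain 0%N) :
  reflect (forall x y (psi : mor x y),
             (Amap psi \o component h x = component h y \o Bmap psi)%VF)
          (h \in Nat).
Proof.
apply: (iffP eqP) => [dh x y psi | hN].
  apply/eqP; rewrite -subr_eq0 -bw_diff0E; apply/eqP.
  by move/cochainP: dh => ->.
apply/cochainP=> x y [w [e psi]]; case: _ / e psi => psi.
by rewrite [LHS]bw_diff0E hN subrr.
Qed.

Section Defect.
Variable g : forall x, Th x -> La x.

Definition gstar : BW 0%N := cochain0 (fun x => precomp k (@g x)).

Definition defect : BW 1%N := cd 0%N gstar.

Variable C : submodClosed (BW 0%N).

Definition correction (h : BW 0%N) : Prop := h \in C /\ gstar + h \in Nat.

Fact defect_cocycle : (defect : subcomplex C 1%N) \in @is_cocycle k (subcomplex C) 1%N.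
Proof. by apply/eqP; apply: (cdd (gstar : BW 0%N)). Qed.

Definition defect_class : cohomology (subcomplex C) 1%N :=
  coh_class (Cocycle defect_cocycle).
End Defect.

End BauesWirsching.
Arguments BW k {Om} Th La.
Arguments Nat {k Om Th La}.
Arguments gstar k {Om Th La} g.
Arguments defect k {Om Th La} g.

Section FullSubcategory.
Variables (I : finType) (X : I -> finType).

Let mor i j : finType := {ffun X i -> X j}.
Let idmor i : mor i i := [ffun a => a].
Let compmor i j l (g : mor j l) (f : mor i j) : mor i l := [ffun a => g (f a)].

Fact full_comp1m i j (f : mor i j) : compmor (idmor j) f = f.
Proof. by apply/ffunP=> a; rewrite !ffunE. Qed.
Fact full_compm1 i j (f : mor i j) : compmor f (idmor i) = f.
Proof. by apply/ffunP=> a; rewrite !ffunE. Qed.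
Fact full_compA i j l m (h : mor l m) (g : mor j l) (f : mor i j) :
  compmor h (compmor g f) = compmor (compmor h g) f.
Proof. by apply/ffunP=> a; rewrite !ffunE. Qed.

Definition full_subcat : fincat := FinCat full_comp1m full_compm1 full_compA.
End FullSubcategory.

Definition const_presheaf (Om : fincat) (T : finType) : presheaf Om :=
  @Presheaf Om (fun _ => T) (fun _ _ _ t => t) (fun _ _ => erefl)
    (fun _ _ _ _ _ _ => erefl).

(* The objects w1 and w2 are the sets 'I_1 and 'I_2; the two groups are
   numbered 0 and 1. *)
Definition groups (b : bool) : finType := 'I_(b.+1).
Definition Omega_full : fincat := full_subcat groups.
Definition w1 : Omega_full := false.
Definition w2 : Omega_full := true.

Section OneWayLayout.
Variables M S : {fset rat}.

Definition params (w : Omega_full) : finType := ({ffun groups w -> M} * S)%type.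

Definition params_mor (v w : Omega_full) (psi : mor v w) (t : params w) :
    params v :=
  ([ffun i => t.1 ((psi : {ffun groups v -> groups w}) i)], t.2).

Fact params_mor1 w (t : params w) : params_mor (idmor w) t = t.
Proof.
by case: t => mu s; congr (_, _); apply/ffunP=> i; rewrite !ffunE.
Qed.
Fact params_morM u v w (g : mor v w) (f : mor u v) (t : params w) :
  params_mor (compmor g f) t = params_mor f (params_mor g t).
Proof. by congr (_, _); apply/ffunP=> i; rewrite !ffunE. Qed.

Definition Theta : presheaf Omega_full := Presheaf params_mor1 params_morM.

Definition disp1 (t : Theta w1) : rat := val t.2.

Definition disp2 (t : Theta w2) : rat :=
  let mu := t.1 : {ffun 'I_2 -> M} in
  val t.2 + (val (mu 0) - val (mu 1)) ^+ 2 / 4.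

Definition targets : {fset rat} := [fset disp2 t | t : Theta w2]%fset.

Definition Lambda : presheaf Omega_full := const_presheaf Omega_full targets.

Fact disp2_target (t : Theta w2) : disp2 t \in targets.
Proof. by apply/imfsetP; exists t. Qed.

Fact disp1_target (t : Theta w1) : disp1 t \in targets.
Proof.
apply/imfsetP; exists ([ffun _ => t.1 (ord0 : 'I_1)], t.2) => //.
by rewrite /disp2 !ffunE subrr expr0n mul0r addr0.
Qed.

Fact within_target (t : Theta w2) : val t.2 \in targets.
Proof.
exact: (disp1_target ([ffun _ => t.1 (ord0 : 'I_2)], t.2)).
Qed.

Definition marginal_dispersion (w : Omega_full) : Theta w -> Lambda w :=
  match w return Theta w -> Lambda w with
  | true => fun t => [` disp2_target t]%fset
  | false => fun t => [` disp1_target t]%fset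
  end.

Definition within_dispersion (t : Theta w2) : Lambda w2 :=
  [` within_target t]%fset.

Definition vanish_merged (k : fieldType) : {pred BW k Theta Lambda 0%N} :=
  fun h => component h w1 == 0.
Arguments vanish_merged : clear implicits.

Fact vanish_merged_submod k : submod_closed (vanish_merged k).
Proof.
split=> [|a h h']; rewrite !unfold_in; first exact: eqxx.
by move=> /eqP h0 /eqP h'0; rewrite /component cochainDE cochainZE
  [h _ _ _]h0 [h' _ _ _]h'0 scaler0 addr0.
Qed.
HB.instance Definition _ (k : fieldType) :=
  GRing.isSubmodClosed.Build k (BW k Theta Lambda 0%N) (vanish_merged k)
    (vanish_merged_submod k).
End OneWayLayout.
Arguments vanish_merged M S k : clear implicits.
Arguments marginal_dispersion {M S w} t : rename.

(* Main.v *)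
Require Import Defs.
From HB Require Import structures.
From mathcomp Require Import all_boot all_order all_algebra.
From mathcomp Require Import finmap.
From mathcomp Require Import boolp.

Set Implicit Arguments.
Unset Strict Implicit.
Unset Printing Implicit Defensive.

Import Order.TTheory GRing.Theory Num.Theory.
Local Open Scope ring_scope.

(** In the complex whose 0-cochains are restricted to [C], the coboundaries of
    degree 1 are the [d h] with [h] in [C], so [d g^*] is one of them exactly
    when some [h] in [C] satisfies [d (g^* + h) = 0], that is when [g] has a
    correction in [C] ([correction_defect_class]).  In the full complex [g^*]
    itself is an admissible 0-cochain, whence [d g^*] is a coboundary there
    ([defect_class_incl]).

    In the one-way layout the target is constant, so a natural family [h]
    satisfies [h_y = A(psi) h_x] for each [psi : x -> y]
    ([Nat_const_component]): as the merged design has a morphism to every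
    design, natural families are determined by their component there.  This
    gives uniqueness.  For existence, the within-group dispersion is invariant
    under every change of design and is the marginal dispersion at the merged
    design; hence its dual is the natural family that extends
    [g^*] from the merged design, and the correction is the difference. *)

Section Corrections.
Variables (k : fieldType) (Om : fincat) (Th La : presheaf Om).
Variable g : forall w : Om, Th w -> La w.
Variable C : submodClosed (BW k Th La 0%N).

(** A correction [h] satisfies [d g^* = d (- h)], so the primitives of the
    defect in [C] are the opposites of the corrections. *)
Lemma correction_defect_class :
  (exists h : BW k Th La 0%N, correction g C h) <-> defect_class g C = 0.
Proof.
have classE : defect_class g C = 0 <->
    exists y : sub0 C, defect k g = cd 0%N (sub0_val y).
  rewrite -(raddf0 (@coh_class _ (subcomplex C) 1%N)) coh_class_eq subr0.
  by split=> [/asboolP | ] // [y dg]; apply/asboolP; exists y.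
rewrite classE; split=> [[h [hC /eqP dh]] | [[y yC] /= dg]].
  have hNC : - h \in C by rewrite -scaleN1r rpredZ.
  exists (Sub0 hNC); apply/eqP.
  by rewrite /= raddfN -addr_eq0 -raddfD; apply/eqP.
exists (- y); split; first by rewrite -scaleN1r rpredZ.
by apply/eqP; rewrite raddfB [X in _ - X](esym dg); apply: subrr.
Qed.

Lemma correction_sub (h h' : BW k Th La 0%N) :
  correction g C h -> correction g C h' -> h - h' \in C /\ h - h' \in Nat.
Proof.
move=> [hC /eqP dh] [h'C /eqP dh'].
split; first by rewrite -scaleN1r rpredD ?rpredZ.
have -> : h - h' = (gstar k g + h) - (gstar k g + h').
  by rewrite [gstar k g + h]addrC addrKA.
by apply/eqP; rewrite raddfB /= dh dh' subrr.
Qed.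

Lemma defect_class_incl :
  coh_map (subcomplex_incl C) (defect_class g C) = 0.
Proof.
rewrite coh_map_class -(raddf0 (@coh_class _ (BW k Th La) 1%N)).
by apply/coh_class_eq; rewrite subr0; apply/asboolP; exists (gstar k g).
Qed.

End Corrections.

Section NaturalFamilies.
Variables (k : fieldType) (Om : fincat).

(** Precomposition with [f_x o Theta(psi)] and with [Lambda(psi) o f_y] gives
    the two sides of the naturality square of [f^*]. *)
Lemma gstar_Nat (Th La : presheaf Om) (f : forall w : Om, Th w -> La w) :
    (forall x y (psi : mor x y) t, f x (pmor Th psi t) = pmor La psi (f y t)) ->
  gstar k f \in Nat.
Proof.
move=> fN; apply/NatP=> x y psi.
rewrite !cochain0E /Amap /Bmap.
rewrite -(@precomp_comp _ _ _ _ _ _ (f x \o pmor Th psi)) //.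
by apply: precomp_comp => t; apply: fN.
Qed.

(** A constant target has [B(psi) = id], so naturality at [psi] computes the
    component at its codomain from the one at its domain. *)
Lemma Nat_const_component (Th : presheaf Om) (T : finType)
    (h : BW k Th (const_presheaf Om T) 0%N) (x y : Om) (psi : mor x y) :
  h \in Nat -> component h y = (Amap k Th psi \o component h x)%VF.
Proof.
move=> /NatP ->.
by rewrite /Bmap precomp_id // comp_lfun1r.
Qed.

End NaturalFamilies.

Section OneWay.
Variables (k : fieldType) (M S : {fset rat}).
Local Notation Th := (Theta M S).
Local Notation La := (Lambda M S).
Local Notation marg := (gstar k (@marginal_dispersion M S)).

Lemma vanish_merged_Nat (h : BW k Th La 0%N) :
  h \in vanish_merged M S k -> h \in Nat -> h = 0.
Proof.
move=> /eqP h1 hN; apply: cochain0P => w.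
have psi : mor w1 w := [ffun _ => ord0 : groups w].
by rewrite (Nat_const_component psi hN) h1 comp_lfun0r.
Qed.

(** A single group has no spread between means, so the within-group dispersion
    is [disp1] at the merged design, where the two families agree. *)
Definition within_family (w : Omega_full) : Th w -> La w :=
  match w return Th w -> La w with
  | true => @within_dispersion M S
  | false => fun t => [` disp1_target t]%fset
  end.

Lemma within_familyE w (t : Th w) : val (within_family t) = val t.2.
Proof. by case: w t. Qed.

Lemma within_family_Nat : gstar k within_family \in Nat.
Proof.
by apply: gstar_Nat => x y psi t; apply: val_inj; rewrite /= !within_familyE.
Qed.

Definition within_correction : BW k Th La 0%N :=
  gstar k within_family - marg.

Lemma within_correctionE : marg + within_correction = gstar k within_family.
Proof. exact: subrKC. Qed.

Lemma within_correctionP :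
  correction (@marginal_dispersion M S) (vanish_merged M S k) within_correction.
Proof.
split; last by rewrite within_correctionE within_family_Nat.
by apply/eqP; apply: subrr.
Qed.

Lemma correction_within (h : BW k Th La 0%N) :
  correction (@marginal_dispersion M S) (vanish_merged M S k) h ->
  h = within_correction.
Proof.
move=> hP; have [dC dN] := correction_sub hP within_correctionP.
by apply/eqP; rewrite -subr_eq0; apply/eqP/vanish_merged_Nat.
Qed.

End OneWay.

Theorem theorem1p5 (k : fieldType) (hk : [pchar k] =i pred0) :
  (forall (Om : fincat) (Th La : presheaf Om)
      (g : forall w : Om, Th w -> La w) (C : submodClosed (BW k Th La 0%N)),
    [/\ ((exists h : BW k Th La 0%N, correction g C h) <->
           defect_class g C = 0),
        (forall h h' : BW k Th La 0%N, correction g C h -> correction g C h' ->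
           h - h' \in C /\ h - h' \in Nat)
      & coh_map (subcomplex_incl C) (defect_class g C) = 0])
  /\
  (forall M S : {fset rat},
      M != fset0 -> S != fset0 -> (forall s : rat, s \in S -> 0 < s) ->
    [/\ (forall h : BW k (Theta M S) (Lambda M S) 0%N,
           h \in vanish_merged M S k -> h \in Nat -> h = 0),
        (exists! h : BW k (Theta M S) (Lambda M S) 0%N,
           correction (@marginal_dispersion M S) (vanish_merged M S k) h)
      & (forall h : BW k (Theta M S) (Lambda M S) 0%N,
           correction (@marginal_dispersion M S) (vanish_merged M S k) h ->
           component (gstar k (@marginal_dispersion M S) + h) w2 =
           precomp k (@within_dispersion M S))]).
Proof.
split=> [Om Th La g C | M S _ _ _].
  split; [exact: correction_defect_class | exact: correction_sub |].
  exact: defect_class_incl.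
split; first exact: vanish_merged_Nat.
  exists (within_correction k M S); split; first exact: within_correctionP.
  by move=> h /correction_within.
by move=> h /correction_within ->; rewrite within_correctionE.
Qed.
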